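(* For any buffer type $B_i\in B$, its best candidate $\alpha_i\in N(v_1)$, which maximizes $P_i(\alpha)$ over $\alpha\in N(v_1)$, is not pruned when the function ConvexPruning is applied to $N(v_1)$.
   Context: A buffer library $B=\{B_1,\dots,B_b\}$ is given, each type $B_i$ having a real intrinsic delay $K(B_i)$ and driving resistance $R(B_i)$. Each candidate $\alpha$ for the subtree $T(v_1)$ of a routing tree rooted at a vertex $v_1$ (a choice of where to insert buffers in $T(v_1)$; there are finitely many) has a real slack $Q(\alpha)$ and a real downstream capacitance $C(\alpha)$ at $v_1$. Candidate $\alpha_1$ dominates $\alpha_2$ if $Q(\alpha_1)\ge Q(\alpha_2)$ and $C(\alpha_1)\le C(\alpha_2)$. The (finite, nonempty) set $N(v_1)$ of nonredundant candidates is a set of candidates of $T(v_1)$ none of which dominates another one in the set, and such that every candidate of $T(v_1)$ is dominated by some member of $N(v_1)$. For a buffer type $B_i$ and $\alpha\in N(v_1)$ define $$P_i(\alpha)=Q(\alpha)-R(B_i)\cdot C(\alpha)-K(B_i).$$ The best candidate for $B_i$ is the $\alpha_i\in N(v_1)$ that maximizes $P_i(\alpha)$ over $\alpha\in N(v_1)$; if there are several maximizers, the one with minimum $C(\alpha)$ is chosen. Convex pruning: a candidate $\alpha_2\in N(v_1)$ is pruned if there are candidates $\alpha_1,\alpha_3\in N(v_1)$ with $C(\alpha_1)<C(\alpha_2)<C(\alpha_3)$ and $$\frac{Q(\alpha_2)-Q(\alpha_1)}{C(\alpha_2)-C(\alpha_1)}<\frac{Q(\alpha_3)-Q(\alpha_2)}{C(\alpha_3)-C(\alpha_2)}.$$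 The function ConvexPruning is a procedure that, given the list of candidates in increasing $Q$ and $C$ order, performs convex pruning, i.e. deletes exactly the pruned candidates. *)

(* Defs.v *)
From HB Require Import structures.
From mathcomp Require Import all_boot all_order all_algebra.
From mathcomp Require Import reals.

Set Implicit Arguments.
Unset Strict Implicit.
Unset Printing Implicit Defensive.

Import Order.TTheory GRing.Theory Num.Theory.
Local Open Scope ring_scope.

(* [cand] is the finite type of the candidates of the subtree T(v1);
   [Q] and [C] give their slack and their downstream capacitance at v1. *)
Section Candidates.
Variables (R : realType) (cand : finType) (Q C : cand -> R).

Definition dominates (a1 a2 : cand) : bool := (Q a2 <= Q a1) && (C a1 <= C a2).

Definition nonredundant_set (N : {set cand}) : Prop :=
  [/\ N != set0,
      forall a1 a2, a1 \in N -> a2 \in N -> a1 != a2 -> ~~ dominates a1 a2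
    & forall a, exists2 a', a' \in N & dominates a' a].

(* A strictly increasing order loses nothing on a nonredundant set, where two
   distinct candidates always differ both in Q and in C. *)
Definition increasing_QC (s : seq cand) : bool :=
  sorted (fun a1 a2 => (Q a1 < Q a2) && (C a1 < C a2)) s.

Definition pruned (S : {pred cand}) (a2 : cand) : bool :=
  (a2 \in S) &&
  [exists a1 in S, exists a3 in S,
    [&& C a1 < C a2, C a2 < C a3
      & (Q a2 - Q a1) / (C a2 - C a1) < (Q a3 - Q a2) / (C a3 - C a2)]].

(* Only the input-output behaviour on increasing lists is specified. *)
Definition performs_convex_pruning (f : seq cand -> seq cand) : Prop :=
  forall s, increasing_QC s -> f s = [seq a <- s | ~~ pruned (mem s) a].

(* The buffer library has b types; [K] and [Rd] give the intrinsic delay and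
   the driving resistance of each of them. *)
Definition bufP (b : nat) (K Rd : 'I_b -> R) (i : 'I_b) (a : cand) : R :=
  Q a - Rd i * C a - K i.

Definition best_candidate (b : nat) (K Rd : 'I_b -> R) (N : {set cand})
    (i : 'I_b) (a : cand) : Prop :=
  [/\ a \in N,
      forall a', a' \in N -> bufP K Rd i a' <= bufP K Rd i a
    & forall a', a' \in N -> bufP K Rd i a' = bufP K Rd i a -> C a <= C a'].

End Candidates.

(* Main.v *)
(* Maximality of P_i at alpha makes R(B_i) a separating slope: every chord
   from a candidate of smaller C up to alpha has slope at least R(B_i), and every
   chord from alpha to a candidate of larger C has slope at most R(B_i).  So the
   slopes do not increase at alpha, and alpha is not pruned. *)
Require Import Defs.
From HB Require Import structures.
From mathcomp Require Import all_boot all_order all_algebra.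
From mathcomp Require Import reals.
From mathcomp Require Import lra.

Import Order.TTheory GRing.Theory Num.Theory.

(** Stated for an arbitrary predicate [S], so that it applies directly to [mem s], relative to which
    a list is pruned. *)
Lemma bufP_max_not_pruned (R : realType) (cand : finType) (Q C : cand -> R)
    (b : nat) (K Rd : 'I_b -> R) (i : 'I_b) (S : {pred cand}) (a : cand) :
  (forall a', a' \in S -> (bufP Q C K Rd i a' <= bufP Q C K Rd i a)%R) ->
  ~~ pruned Q C S a.
Proof.
move=> amax; apply/negP => /andP[_ /exists_inP[a1 a1S /exists_inP[a3 a3S]]].
move=> /and3P[C1 C3]; apply/negP; rewrite -leNgt.
move: (amax _ a1S) (amax _ a3S); rewrite /bufP => P1 P3.
apply: (@le_trans _ _ (Rd i)).
  (* With the positive denominator cleared, this is [P3], where [K i] cancels; the chord from [a1]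
     follows from [P1] likewise. *)
  by rewrite ler_pdivrMr ?subr_gt0 // mulrBr; lra.
by rewrite ler_pdivlMr ?subr_gt0 // mulrBr; lra.
Qed.

Theorem lemma3 (R : realType) (b : nat) (K Rd : 'I_b -> R)
    (cand : finType) (Q C : cand -> R) (N : {set cand})
    (hN : nonredundant_set Q C N)
    (ConvexPruning : seq cand -> seq cand)
    (hCP : performs_convex_pruning Q C ConvexPruning)
    (s : seq cand) (hs : increasing_QC Q C s) (hsN : s =i N)
    (i : 'I_b) (alpha : cand) (halpha : best_candidate Q C K Rd N i alpha) :
  alpha \in ConvexPruning s.
Proof.
have [alphaN alphamax _] := halpha.
rewrite (hCP _ hs) mem_filter hsN alphaN andbT.
(* Maximality over [N] carries over to the list, since [s] and [N] have the same members. *)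
apply: (@bufP_max_not_pruned _ _ Q C _ K Rd i) => a' a's.
by apply: alphamax; rewrite -hsN; exact: a's.
Qed.
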